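(* Let $N$ be a $k$-step nilspace ($k\ge1$). Then the group $\mathrm{Trans}(N)$ is $k$-nilpotent and $\{\mathrm{Trans}_i(N)\}_{i=1}^{k+1}$ is a central series in it.
   Context: Notation: $0^n=(0,\dots,0)$ and $1^n=(1,\dots,1)$ in $\{0,1\}^n$. A cube morphism $\phi:\{0,1\}^n\to\{0,1\}^m$ is a map each of whose coordinate functions is one of $0$, $1$, $x_j$, $1-x_j$ for some $j$. A nilspace is a set $N$ with sets $C^n(N)\subseteq N^{\{0,1\}^n}$ ($n\ge 0$) of cubes such that: (composition) if $\phi:\{0,1\}^n\to\{0,1\}^m$ is a cube morphism and $f\in C^m(N)$ then $f\circ\phi\in C^n(N)$; (ergodicity) $C^1(N)=N^{\{0,1\}}$; (gluing) every map $f:\{0,1\}^n\setminus\{1^n\}\to N$ whose restrictions to the $(n-1)$-dimensional faces containing $0^n$ are all cubes extends to an element of $C^n(N)$. It is a $k$-step nilspace if in the gluing axiom for $n=k+1$ the extension is unique. For $i\ge1$, $\mathrm{Trans}_i(N)$ (translations of height $i$) is the set of maps $\alpha:N\to N$ such that for every $n\ge i$, every $(n-i)$-dimensional face $F\subseteq\{0,1\}^n$ and every $c\in C^n(N)$, the map equal to $\alpha(c(v))$ for $v\in F$ and to $c(v)$ for $v\notin F$ is in $C^n(N)$. $\mathrm{Trans}(N)=\mathrm{Trans}_1(N)$; for finite-step $N$ these are groups under composition. A group is $k$-nilpotent if its $k$-fold iterated commutator $[\dots[[L,L],L],\dots,L]$ is trivial, i.e. its nilpotency class is at most $k$. A central series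 $\{G_i\}_{i=1}^{k+1}$ in $G$ is a decreasing sequence of subgroups with $G_1=G$, $G_{k+1}=\{1\}$ and $[G_i,G_j]\subseteq G_{i+j}$ for all $i,j$ (with $G_m=\{1\}$ for $m>k+1$). *)

(* Defs.v *)
From HB Require Import structures.
From mathcomp Require Import all_boot.
From mathcomp Require Import boolp classical_sets.

Set Implicit Arguments.
Unset Strict Implicit.
Unset Printing Implicit Defensive.

Local Open Scope classical_set_scope.

Definition cube (n : nat) := {ffun 'I_n -> bool}.

Definition cube1 (n : nat) : cube n := [ffun => true].

Definition cube_morphism (n m : nat) (phi : cube n -> cube m) : Prop :=
  forall i : 'I_m,
    [\/ forall v, phi v i = false,
        forall v, phi v i = true,
        exists j : 'I_n, forall v, phi v i = v j |
        exists j : 'I_n, forall v, phi v i = ~~ v j].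

(* [T] is the set of free coordinates; the other ones agree with [w]. *)
Definition is_face (n d : nat) (F : {set cube n}) : Prop :=
  exists (T : {set 'I_n}) (w : cube n),
    #|T| = d /\
    forall v, (v \in F) = [forall j, (j \notin T) ==> (v j == w j)].

(* Parametrizes the n-dimensional face [v_i = 0] of the (n+1)-cube; as [i]
   varies, these are exactly the codimension 1 faces that contain 0^(n+1). *)
Definition face0 (n : nat) (i : 'I_n.+1) (v : cube n) : cube n.+1 :=
  [ffun j => if unlift i j is Some j' then v j' else false].

(* A map on the (n+1)-cube minus 1^(n+1) is represented by a total map whose
   value at 1^(n+1) is never used. Every total map arises, and every partial
   map is represented, since the domain of a partial map contains 0^(n+1). *)
Definition corner (N : Type) (C : forall n, set (cube n -> N)) (n : nat)
    (f : cube n.+1 -> N) : Prop :=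
  forall i : 'I_n.+1, C n (f \o face0 i).

Definition extends (N : Type) (n : nat) (c f : cube n -> N) : Prop :=
  forall v, v != cube1 n -> c v = f v.

(* Gluing is required in dimensions n >= 1 only: the corner 0^n has to lie in
   the domain of the partial map. In dimension 0 it would only add that the
   nilspace is nonempty, so the empty nilspace is allowed here. *)
Record nilspace := Nilspace {
  carrier :> Type;
  cubes : forall n, set (cube n -> carrier);
  cubes_comp : forall n m (phi : cube n -> cube m), cube_morphism phi ->
    forall f, cubes f -> cubes (f \o phi);
  cubes_ergodic : @cubes 1 = setT;
  cubes_glue : forall n (f : cube n.+1 -> carrier), corner cubes f ->
    exists c, cubes c /\ extends c f
}.

Definition is_step (k : nat) (N : nilspace) : Prop :=
  forall f : cube k.+1 -> N, corner (@cubes N) f ->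
    exists! c, cubes c /\ extends c f.

Definition translation (N : nilspace) (i : nat) (a : N -> N) : Prop :=
  forall n, i <= n -> forall F : {set cube n}, is_face (n - i) F ->
    forall c, cubes c -> cubes (fun v => if v \in F then a (c v) else c v).

(* The group of all permutations of a possibly infinite type, under
   composition. *)
Record sym (T : Type) := Sym {
  sym_fun :> T -> T;
  sym_inv : T -> T;
  sym_funK : cancel sym_fun sym_inv;
  sym_invK : cancel sym_inv sym_fun
}.

Section SymGroup.
Variable T : Type.
Implicit Types s t : sym T.

Lemma sym_inj s t : (s : T -> T) = t -> s = t.
Proof.
case: s t => [f g fK gK] [f' g' fK' gK'] /= eqf; move: fK' gK'; rewrite -eqf.
move=> fK' gK'; have eqg : g' = g by apply: funext => x; rewrite -[x in LHS]gK fK'.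
by move: fK' gK'; rewrite eqg => fK' gK'; congr Sym; apply: Prop_irrelevance.
Qed.

HB.instance Definition _ := gen_eqMixin (sym T).
HB.instance Definition _ := gen_choiceMixin (sym T).

Definition sym1 : sym T := @Sym T id id (fun=> erefl) (fun=> erefl).
Definition symV s : sym T := Sym (@sym_invK T s) (@sym_funK T s).
Definition symM s t : sym T :=
  @Sym T (s \o t) (sym_inv t \o sym_inv s)
    (can_comp (@sym_funK T s) (@sym_funK T t))
    (can_comp (@sym_invK T t) (@sym_invK T s)).

Let symA : associative symM. Proof. by move=> s t u; apply: sym_inj. Qed.
Let sym1M : left_id sym1 symM. Proof. by move=> s; apply: sym_inj. Qed.
Let symM1 : right_id sym1 symM. Proof. by move=> s; apply: sym_inj. Qed.
Let symVM : left_inverse sym1 symV symM.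
Proof. by move=> s; apply: sym_inj; apply: funext => x; apply: sym_funK. Qed.
Let symMV : right_inverse sym1 symV symM.
Proof. by move=> s; apply: sym_inj; apply: funext => x; apply: sym_invK. Qed.

HB.instance Definition _ :=
  isGroup.Build (sym T) symA sym1M symM1 symVM symMV.

End SymGroup.

Section Commutators.
Variable G : groupType.
Implicit Types (A B H : set G) (S : nat -> set G).

Definition subgroup A : Prop := group_closed [in A].

Definition commutator A B : set G :=
  smallest subgroup [set z | exists x y, [/\ A x, B y & z = [~ x, y]%g]].

Definition nilpotent (k : nat) H : Prop :=
  iter k (fun L => commutator L H) H = [set 1%g].

(* Only the terms [S 1], ..., [S k.+1] are relevant. *)
Definition central_series (k : nat) H S : Prop :=
  [/\ S 1 = H, S k.+1 = [set 1%g],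
      forall i, 1 <= i <= k.+1 -> subgroup (S i),
      forall i, 1 <= i <= k -> S i.+1 `<=` S i &
      forall i j, 1 <= i <= k.+1 -> 1 <= j <= k.+1 ->
        commutator (S i) (S j) `<=`
          if i + j <= k.+1 then S (i + j) else [set 1%g]].

End Commutators.

Definition Trans (N : nilspace) (i : nat) : set (sym N) :=
  [set s | translation i s].

Arguments translation N i a : clear implicits.
Arguments Trans N i : clear implicits.

(* Main.v *)
Require Import Defs.
From mathcomp Require Import all_boot.
From mathcomp Require Import boolp classical_sets.
From mathcomp Require Import finset.

(** A map modified by translations of heights [i] and [j] on two faces that meet
    in a face of codimension [i + j] shows that commutators add heights, and
    uniqueness of gluing in dimension [k+1] makes translations of height [k+1]
    trivial. The remaining point is that translations are invertible, with
    inverses of the same height. Call [x] and [y] related in dimension [n] if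
    the [n]-cube equal to [x] everywhere except for [y] at [1^n] is in [C^n(N)];
    by concatenation of cubes, changing the top value [p] of any [n]-cube to [q]
    gives a cube if and only if [p] and [q] are related. In dimension [0] this
    relation is total and in dimension [k+1] it is equality, and gluing lifts a
    solution [x] of [a x = y] up to the relation in dimension [n] to one in
    dimension [n+1]. *)

Set Implicit Arguments.
Unset Strict Implicit.
Unset Printing Implicit Defensive.

(** * Operations on discrete cubes *)

Lemma cube_morphism_comp l m n (phi : cube l -> cube m) (psi : cube m -> cube n) :
  cube_morphism phi -> cube_morphism psi -> cube_morphism (psi \o phi).
Proof.
move=> phiP psiP i; case: (psiP i) => [e|e|[j e]|[j e]].
- by apply: Or41 => v; apply: e.
- by apply: Or42 => v; apply: e.
- case: (phiP j) => [d|d|[l' d]|[l' d]].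
  + by apply: Or41 => v; rewrite /= e d.
  + by apply: Or42 => v; rewrite /= e d.
  + by apply: Or43; exists l' => v; rewrite /= e d.
  + by apply: Or44; exists l' => v; rewrite /= e d.
- case: (phiP j) => [d|d|[l' d]|[l' d]].
  + by apply: Or42 => v; rewrite /= e d.
  + by apply: Or41 => v; rewrite /= e d.
  + by apply: Or44; exists l' => v; rewrite /= e d.
  + by apply: Or43; exists l' => v; rewrite /= e d negbK.
Qed.

Definition cube_set n (i : 'I_n) (b : bool) (v : cube n) : cube n :=
  [ffun j => if j == i then b else v j].

Definition cube_flip n (i : 'I_n) (v : cube n) : cube n :=
  [ffun j => (j == i) (+) v j].

Definition cube_cons n (b : bool) (v : cube n) : cube n.+1 :=
  [ffun j => if unlift ord0 j is Some j' then v j' else b].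

Definition cube_del n (i : 'I_n.+1) (v : cube n.+1) : cube n :=
  [ffun j => v (lift i j)].

Definition cube_split m n (u : cube m) (v : cube n) : cube (m + n) :=
  [ffun j => match split j with inl i => u i | inr i => v i end].

Lemma cube_morphism_set n (i : 'I_n) b : cube_morphism (cube_set i b).
Proof.
move=> j; have [<-|ne] := eqVneq j i.
  by case: b; [apply: Or42 | apply: Or41] => v; rewrite ffunE eqxx.
by apply: Or43; exists j => v; rewrite ffunE (negPf ne).
Qed.

Lemma cube_morphism_flip n (i : 'I_n) : cube_morphism (cube_flip i).
Proof.
move=> j; case: (eqVneq j i) => [->|ne].
  by apply: Or44; exists i => v; rewrite ffunE eqxx addTb.
by apply: Or43; exists j => v; rewrite ffunE (negPf ne).
Qed.

Lemma cube_morphism_cons n b : cube_morphism (@cube_cons n b).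
Proof.
move=> j; case: (unliftP ord0 j) => [j' ->|->].
  by apply: Or43; exists j' => v; rewrite ffunE liftK.
by case: b; [apply: Or42 | apply: Or41] => v; rewrite ffunE unlift_none.
Qed.

Lemma cube_morphism_face0 n (i : 'I_n.+1) : cube_morphism (face0 i).
Proof.
move=> j; case: (unliftP i j) => [j' ->|->].
  by apply: Or43; exists j' => v; rewrite ffunE liftK.
by apply: Or41 => v; rewrite ffunE unlift_none.
Qed.

Lemma cube_morphism_del n (i : 'I_n.+1) : cube_morphism (cube_del i).
Proof. by move=> j; apply: Or43; exists (lift i j) => v; rewrite ffunE. Qed.

Lemma cube_morphism_cst m n (u : cube n) : cube_morphism (fun _ : cube m => u).
Proof. by move=> j; case: (u j); [apply: Or42 | apply: Or41]. Qed.

Lemma cube_morphism_id n : cube_morphism (@id (cube n)).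
Proof. by move=> j; apply: Or43; exists j. Qed.

Lemma cube_morphism_coord m n (s : 'I_m -> 'I_n) :
  cube_morphism (fun v : cube n => [ffun j => v (s j)] : cube m).
Proof. by move=> j; apply: Or43; exists (s j) => v; rewrite ffunE. Qed.

Lemma cube_morphism_split l m n (phi : cube l -> cube m) (psi : cube l -> cube n) :
  cube_morphism phi -> cube_morphism psi ->
  cube_morphism (fun v => cube_split (phi v) (psi v)).
Proof.
move=> phiP psiP j; case E: (split j) => [i|i].
  by case: (phiP i) => [e|e|[h e]|[h e]];
    [apply: Or41|apply: Or42|apply: Or43; exists h|apply: Or44; exists h];
    move=> v; rewrite ffunE E e.
by case: (psiP i) => [e|e|[h e]|[h e]];
  [apply: Or41|apply: Or42|apply: Or43; exists h|apply: Or44; exists h];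
  move=> v; rewrite ffunE E e.
Qed.

Lemma cube_split_eq1 m n (u : cube m) (v : cube n) :
  (cube_split u v == cube1 (m + n)) = (u == cube1 m) && (v == cube1 n).
Proof.
apply/eqP/andP => [/ffunP e|[/eqP -> /eqP ->]]; last first.
  by apply/ffunP => j; rewrite !ffunE; case: (split j) => i; rewrite ffunE.
split; apply/eqP/ffunP => i.
  by have := e (lshift n i); rewrite !ffunE (unsplitK (inl i)).
by have := e (rshift m i); rewrite !ffunE (unsplitK (inr i)).
Qed.

Lemma cube_del_face0 n (i : 'I_n.+1) v : cube_del i (face0 i v) = v.
Proof. by apply/ffunP => j; rewrite !ffunE liftK. Qed.

Lemma face0_del n (i : 'I_n.+1) v : face0 i (cube_del i v) = cube_set i false v.
Proof.
apply/ffunP => j; rewrite !ffunE; case: unliftP => [j' ->|->].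
  by rewrite ffunE eq_sym (negPf (neq_lift _ _)).
by rewrite eqxx.
Qed.

Lemma cube_set_id n (i : 'I_n) b (v : cube n) : v i = b -> cube_set i b v = v.
Proof. by move=> <-; apply/ffunP => j; rewrite ffunE; case: eqP => [->|]. Qed.

Lemma cube_set_lift n (i : 'I_n.+1) j b v :
  face0 i (cube_set j b v) = cube_set (lift i j) b (face0 i v).
Proof.
apply/ffunP => h; rewrite !ffunE; case: (unliftP i h) => [h' ->|->].
  by rewrite ffunE (inj_eq lift_inj).
by rewrite (negPf (neq_lift _ _)).
Qed.

Lemma cube_eq1F n (i : 'I_n) (v : cube n) : v i = false -> (v == cube1 n) = false.
Proof. by move=> vi; apply/eqP => e; move: vi; rewrite e ffunE. Qed.

Lemma cube_cons_eq1 n b (v : cube n) :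
  (cube_cons b v == cube1 n.+1) = b && (v == cube1 n).
Proof.
apply/eqP/andP => [/ffunP e|[-> /eqP ->]].
  split; first by have := e ord0; rewrite !ffunE unlift_none.
  by apply/eqP/ffunP => i; have := e (lift ord0 i); rewrite !ffunE liftK.
by apply/ffunP => i; rewrite !ffunE; case: unlift => // j; rewrite ffunE.
Qed.

Lemma cube_consK n b (v : cube n) : cube_del ord0 (cube_cons b v) = v.
Proof. by apply/ffunP => j; rewrite !ffunE liftK. Qed.

Lemma cube_cons0 n b (v : cube n) : cube_cons b v ord0 = b.
Proof. by rewrite ffunE unlift_none. Qed.

Lemma cube_cons_lift n b (v : cube n) i : cube_cons b v (lift ord0 i) = v i.
Proof. by rewrite ffunE liftK. Qed.

Lemma cube_consE n (v : cube n.+1) : v = cube_cons (v ord0) (cube_del ord0 v).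
Proof.
by apply/ffunP => j; rewrite ffunE; case: unliftP => [i ->|->] //; rewrite ffunE.
Qed.

(** * Basic cubes, extension from faces, concatenation *)

Section Nilspace.
Variable N : nilspace.
Implicit Types (a : N -> N) (x y z : N).

Lemma eq_cubes n (f g : cube n -> N) : f =1 g -> cubes f -> cubes g.
Proof. by move=> /funext ->. Qed.

(** Pullback along coordinate [i] of a map on the 1-cube, which is a cube by ergodicity. *)
Lemma cubes_edge n (i : 'I_n) x y : cubes (fun v : cube n => if v i then y else x).
Proof.
have phiP : cube_morphism (fun v : cube n => [ffun => v i] : cube 1).
  by move=> j; apply: Or43; exists i => v; rewrite ffunE.
have: cubes (fun v : cube 1 => if v ord0 then y else x) by rewrite cubes_ergodic.
by move=> /(cubes_comp phiP); apply: eq_cubes => v /=; rewrite ffunE.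
Qed.

Lemma cubes_cst n x : cubes (fun _ : cube n => x).
Proof.
have := cubes_comp (cube_morphism_cst n (cube1 1)) (cubes_edge ord0 x x).
by apply: eq_cubes => v /=; rewrite if_same.
Qed.

Lemma cubes0 (f : cube 0 -> N) : cubes f.
Proof.
apply: eq_cubes (cubes_cst 0 (f (cube1 0))) => v.
by congr f; apply/ffunP => -[].
Qed.

(* Fill the faces [v_l = 0] with [l] outside [J] one at a time, each by
   induction on the dimension; when no such face is left, glue. *)
Lemma extend_faces n (J : {set 'I_n}) (f : cube n -> N) : J != set0 ->
  (forall j, j \in J -> cubes (f \o cube_set j false)) ->
  exists2 c : cube n -> N, cubes c & forall j (v : cube n), j \in J -> v j = false -> c v = f v.
Proof.
elim: n J f => [|n IHn] J f; first by case/set0Pn => -[].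
have [m] := ubnP #|~: J|; elim: m J f => // m IHm J f ltJ J0 fJ.
have [l lJ|JT] := pickP [in ~: J]; last first.
  have JA j : j \in J by have := JT j; rewrite /= inE => /negbFE.
  have cf : corner (@cubes N) f.
    move=> i; have := cubes_comp (cube_morphism_face0 i) (fJ i (JA i)).
    by apply: eq_cubes => v /=; rewrite -face0_del cube_del_face0.
  have [c [cC cE]] := cubes_glue cf.
  by exists c => // j v _ vj; apply: cE; rewrite (cube_eq1F vj).
have lJ' : l \notin J by move: lJ; rewrite /= inE.
have [j0 j0J] := set0Pn _ J0.
pose J' := [set j : 'I_n | lift l j \in J].
have J'0 : J' != set0.
  apply/set0Pn; case: (unliftP l j0) => [j e|e]; last by rewrite -e j0J in lJ'.
  by exists j; rewrite inE -e.
have fJ' j : j \in J' -> cubes ((f \o face0 l) \o cube_set j false).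
  rewrite inE => /fJ /(cubes_comp (cube_morphism_face0 l)).
  by apply: eq_cubes => v /=; rewrite cube_set_lift.
have [h hC hE] := IHn J' (f \o face0 l) J'0 fJ'.
(* The values of [f] on the face [v_l = 0] are replaced by [h]; the faces in [J] keep theirs, so [l]
   can be added to [J]. *)
pose f' (v : cube n.+1) := if v l then f v else h (cube_del l v).
have f'E j (v : cube n.+1) : j \in J -> v j = false -> f' v = f v.
  move=> jJ vj; rewrite /f'; case vl: (v l) => //.
  case: (unliftP l j) => [i e|e]; last by rewrite -e jJ in lJ'.
  rewrite (hE i) ?inE -?e //= ?face0_del ?cube_set_id //.
  by rewrite ffunE -e.
have [|||c cC cE] := IHm (l |: J) f'.
- rewrite -ltnS; apply: leq_trans ltJ; rewrite ltnS; apply: proper_card.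
  rewrite properC; apply/properP; split; first exact: subsetUr.
  by exists l; rewrite ?setU11.
- by apply/set0Pn; exists l; rewrite setU11.
- move=> j /setU1P[->|jJ].
    apply: eq_cubes (cubes_comp (cube_morphism_del l) hC) => v /=.
    rewrite /f' ffunE eqxx; congr h; apply/ffunP => i.
    by rewrite !ffunE eq_sym (negPf (neq_lift _ _)).
  by apply: eq_cubes (fJ j jJ) => v /=; rewrite (f'E j) // ffunE eqxx.
- exists c => // j v jJ vj; rewrite (cE j) ?(f'E j) //.
  by rewrite inE jJ orbT.
Qed.

(* The two cubes are placed along two edges of a square at a common vertex;
   the new cube is the antidiagonal of the completed square. *)
Lemma cubes_concat n (i : 'I_n) (c d : cube n -> N) : cubes c -> cubes d ->
  (forall v : cube n, v i = false -> c v = d v) ->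
  cubes (fun v => if v i then d v else c (cube_set i true v)).
Proof.
move=> cC dC cd.
pose f (w : cube n.+1) := let v := cube_del ord0 w in
  if w ord0 then d (cube_set i true v) else c v.
pose li := lift ord0 i.
have [||h hC hE] := @extend_faces n.+1 [set ord0; li] f.
- by apply/set0Pn; exists ord0; rewrite set21.
- move=> j /set2P[] ->.
    apply: eq_cubes (cubes_comp (cube_morphism_del ord0) cC) => w /=.
    rewrite /f ffunE eqxx; congr c; apply/ffunP => h.
    by rewrite !ffunE eq_sym (negPf (neq_lift _ _)).
  (* Where [li] is 0, [f] is [d] with its coordinate [i] read from [ord0]; at [ord0 = 0] this is the
     agreement of [c] and [d]. *)
  have phiP : cube_morphism
      (fun w : cube n.+1 => [ffun j => if j == i then w ord0 else w (lift ord0 j)] : cube n).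
    move=> h; apply: Or43; exists (if h == i then ord0 else lift ord0 h) => v.
    by rewrite ffunE; case: ifP.
  apply: eq_cubes (cubes_comp phiP dC) => w /=; rewrite /f.
  have E1 : cube_set li false w ord0 = w ord0.
    by rewrite ffunE (negPf (neq_lift _ _)).
  rewrite E1; case w0: (w ord0).
    congr d; apply/ffunP => h; rewrite !ffunE; case: eqP => // /eqP ne.
    by rewrite (inj_eq lift_inj) (negPf ne).
  rewrite cd; last by rewrite !ffunE eqxx.
  by congr d; apply/ffunP => h; rewrite !ffunE (inj_eq lift_inj).
pose psi (v : cube n) : cube n.+1 := cube_cons (v i) (cube_flip i v).
have psiP : cube_morphism psi.
  move=> j; case: (unliftP ord0 j) => [j' ->|->].
    have [->|ne] := eqVneq j' i.
      by apply: Or44; exists i => v; rewrite cube_cons_lift ffunE eqxx.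
    by apply: Or43; exists j' => v; rewrite cube_cons_lift ffunE (negPf ne).
  by apply: Or43; exists i => v; rewrite cube_cons0.
apply: eq_cubes (cubes_comp psiP hC) => v /=; case vi: (v i).
  rewrite (hE li) ?set22 //; last first.
    by rewrite cube_cons_lift ffunE eqxx vi.
  rewrite /f cube_cons0 vi cube_consK; congr d; apply/ffunP => j.
  by rewrite !ffunE; case: eqP => // ->.
rewrite (hE ord0) ?set21 //; last by rewrite cube_cons0.
rewrite /f cube_cons0 vi cube_consK; congr c; apply/ffunP => j.
by rewrite !ffunE; case: eqP => // ->; rewrite vi.
Qed.

(** * Changing the top value of a cube *)

Definition set_top n (c : cube n -> N) (q : N) (v : cube n) : N :=
  if v == cube1 n then q else c v.

Lemma set_top1 n (c : cube n -> N) q : set_top c q (cube1 n) = q.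
Proof. by rewrite /set_top eqxx. Qed.

Lemma set_topF n (c : cube n -> N) q i (v : cube n) : v i = false -> set_top c q v = c v.
Proof. by rewrite /set_top => /cube_eq1F ->. Qed.

(** [crel n.+1] is the equivalence relation whose quotient is the [n]-step factor of the
    nilspace. *)
Definition crel n x y := cubes (set_top (fun _ : cube n => x) y).

(** One direction concatenates [c] with [set_top c q], the other the reflection of [c] in coordinate
    [i] with the right-hand cube. *)
Lemma set_top_cubes_set n (c : cube n -> N) q i : cubes c ->
  cubes (set_top c q) <-> cubes (set_top (c \o cube_set i true) q).
Proof.
move=> cC; split=> dC.
  have cE (v : cube n) : v i = false -> c v = set_top c q v by move=> /set_topF ->.
  have := cubes_concat cC dC cE; apply: eq_cubes => v; case vi: (v i).
    by rewrite /set_top /= cube_set_id.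
  by rewrite (set_topF _ _ vi).
have c'C := cubes_comp (cube_morphism_flip i) cC.
have cE (v : cube n) : v i = false ->
    (c \o cube_flip i) v = set_top (c \o cube_set i true) q v.
  move=> vi; rewrite (set_topF _ _ vi) /=; congr c; apply/ffunP => j.
  by rewrite !ffunE; case: eqP => [->|//]; rewrite vi.
have := cubes_concat c'C dC cE; apply: eq_cubes => v; case vi: (v i).
  by rewrite /set_top /= cube_set_id.
rewrite (set_topF _ _ vi) /=; congr c; apply/ffunP => j.
by rewrite !ffunE; case: eqP => [->|//]; rewrite vi.
Qed.

(** Raising the coordinates to 1 one after another turns [c] into the constant cube at its top
    value. *)
Lemma set_top_cubes n (c : cube n -> N) q : cubes c ->
  cubes (set_top c q) <-> crel n (c (cube1 n)) q.
Proof.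
pose up (s : seq 'I_n) (v : cube n) : cube n := [ffun j => (j \in s) || v j].
have upP (s : seq 'I_n) d : cubes d ->
    cubes (set_top d q) <-> cubes (set_top (d \o up s) q).
  elim: s d => [|i s IHs] d dC.
    suff -> : d \o up [::] = d by [].
    by apply: funext => v /=; congr d; apply/ffunP => j; rewrite ffunE.
  rewrite (set_top_cubes_set _ i dC).
  rewrite (IHs _ (cubes_comp (cube_morphism_set i true) dC)).
  suff -> : (d \o cube_set i true) \o up s = d \o up (i :: s) by [].
  apply: funext => v /=; congr d; apply/ffunP => j; rewrite !ffunE inE.
  by case: eqP.
move=> /(upP (enum 'I_n)) ->.
suff -> : c \o up (enum 'I_n) = fun=> c (cube1 n) by [].
apply: funext => v /=; congr c; apply/ffunP => j.
by rewrite !ffunE mem_enum.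
Qed.

Lemma crel0 x y : crel 0 x y.
Proof. exact: cubes0. Qed.

Lemma crel_trans n x y z : crel n x y -> crel n y z -> crel n x z.
Proof.
move=> xy yz; rewrite -(set_top1 (fun _ : cube n => x) y) in yz.
have := (set_top_cubes z xy).2 yz.
by apply: eq_cubes => v; rewrite /set_top; case: eqP.
Qed.

(** Restriction to the face where the first coordinate is 1. *)
Lemma crelS n x y : crel n.+1 x y -> crel n x y.
Proof.
move=> /(cubes_comp (cube_morphism_cons (n := n) true)).
by apply: eq_cubes => v /=; rewrite /set_top cube_cons_eq1.
Qed.

Lemma crel_leq m n x y : m <= n -> crel n x y -> crel m x y.
Proof.
move=> /subnK <-; elim: (n - m) => // d IHd; rewrite addSn => /crelS; exact: IHd.
Qed.

(** * Translations via cube morphisms, and commutators *)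

Definition on_top i n (phi : cube n -> cube i) a (c : cube n -> N) v :=
  if phi v == cube1 i then a (c v) else c v.

(* Faces of codimension [i] are the preimages of [1^i] under a cube morphism,
   up to passing to a larger cube; this class of sets is closed under
   preimages, which faces of a given codimension are not. *)
Lemma translationP i a : translation N i a <->
  forall n (phi : cube n -> cube i), cube_morphism phi ->
  forall c, cubes c -> cubes (on_top phi a c).
Proof.
split=> [aT n phi phiP c cC|aT n le_in F [T [w [cardT FE]]] c cC].
  (* [c] is extended to the [n + i]-cube independently of the last [i] coordinates; the map [v] to
     [(v, phi v)] pulls the face [F] back to the preimage of [1^i]. *)
  pose F := [set w : cube (n + i) | [forall j, w (rshift n j)]].
  have Ff : is_face (n + i - i) F.
    rewrite addnK; exists [set lshift i j | j : 'I_n], (cube1 (n + i)); split.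
      by rewrite card_imset ?card_ord //; apply: lshift_inj.
    move=> v; rewrite inE; apply/forallP/forallP => e j.
      apply/implyP; rewrite -(splitK j); case: (split j) => h /=.
        by rewrite imset_f.
      by rewrite e ffunE.
    have /implyP := e (rshift n j); rewrite ffunE => /(_ _)/eqP -> //.
    by apply/imsetP => -[h _] /eqP; rewrite eq_rlshift.
  have := aT _ (leq_addl n i) F Ff _
    (cubes_comp (cube_morphism_coord (lshift i)) cC).
  move=> /(cubes_comp (cube_morphism_split (@cube_morphism_id n) phiP)).
  apply: eq_cubes => v /=; rewrite /on_top.
  have -> : [ffun j => cube_split v (phi v) (lshift i j)] = v.
    by apply/ffunP => j; rewrite !ffunE (unsplitK (inl j)).
  congr (if _ then _ else _); rewrite inE; apply/forallP/eqP => [e|e j].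
    by apply/ffunP => j; have := e j; rewrite !ffunE (unsplitK (inr j)).
  by rewrite ffunE (unsplitK (inr j)) e ffunE.
have cardTC : #|~: T| = i by rewrite cardsCs setCK cardT card_ord subKn.
(* [phi] tests agreement with [w] on each fixed coordinate, so [F] is the preimage of [1^i]. *)
pose phi (v : cube n) : cube i :=
  [ffun j => v (enum_val (cast_ord (esym cardTC) j))
       == w (enum_val (cast_ord (esym cardTC) j))].
have phiP : cube_morphism phi.
  move=> j; set h := enum_val (cast_ord (esym cardTC) j).
  case wh: (w h); [apply: Or43 | apply: Or44]; exists h => v;
    by rewrite ffunE -/h wh ?eqb_id ?eqbF_neg.
apply: eq_cubes (aT n phi phiP c cC) => v; rewrite /on_top.
congr (if _ then _ else _); rewrite FE; apply/eqP/forallP => [/ffunP e j|e].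
  apply/implyP => jT; have jT' : j \in ~: T by rewrite inE.
  have := e (cast_ord cardTC (enum_rank_in jT' j)).
  by rewrite !ffunE cast_ordK enum_rankK_in.
apply/ffunP => j; rewrite !ffunE; apply: (implyP (e _)).
by have := enum_valP (cast_ord (esym cardTC) j); rewrite inE.
Qed.

Lemma translation_id i : translation N i id.
Proof.
apply/translationP => n phi _ c; apply: eq_cubes => v.
by rewrite /on_top if_same.
Qed.

Lemma translation_comp i a b :
  translation N i a -> translation N i b -> translation N i (a \o b).
Proof.
move=> /translationP aT /translationP bT.
apply/translationP => n phi phiP c /(bT n phi phiP) /(aT n phi phiP); apply: eq_cubes => v.
by rewrite /on_top /=; case: (phi v == _).
Qed.

(** Prepending a constant coordinate 1 to [phi] writes a preimage of [1^i] as one of [1^(i+1)]. *)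
Lemma translationS i a : translation N i.+1 a -> translation N i a.
Proof.
move=> /translationP aT; apply/translationP => n phi phiP c.
move=> /(aT n _ (cube_morphism_comp phiP (cube_morphism_cons true))).
by apply: eq_cubes => v; rewrite /on_top /= cube_cons_eq1.
Qed.

Lemma translation_leq i j a : i <= j -> translation N j a -> translation N i a.
Proof.
move=> /subnK <-; elim: (j - i) => // d IHd; rewrite addSn => /translationS.
exact: IHd.
Qed.

(** Split [phi] into [phi1] and [phi2], and apply [b], [a], [b'], [a'] in turn on the preimages of
    [1^j] and [1^i]; outside their intersection each map cancels with its inverse. *)
Lemma translation_commutator i j a a' b b' : cancel a a' -> cancel b b' ->
  translation N i a -> translation N i a' ->
  translation N j b -> translation N j b' ->
  translation N (i + j) (a' \o b' \o a \o b).
Proof.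
move=> aK bK /translationP aT /translationP a'T /translationP bT
  /translationP b'T.
apply/translationP => n phi phiP c.
pose phi1 (v : cube n) : cube i := [ffun h => phi v (lshift j h)].
pose phi2 (v : cube n) : cube j := [ffun h => phi v (rshift i h)].
have phi1P : cube_morphism phi1.
  exact: cube_morphism_comp phiP (cube_morphism_coord (lshift j)).
have phi2P : cube_morphism phi2.
  exact: cube_morphism_comp phiP (cube_morphism_coord (@rshift i j)).
have phiE v : phi v = cube_split (phi1 v) (phi2 v).
  by apply/ffunP => h; rewrite ffunE -{1}(splitK h); case: split => l; rewrite ffunE.
move=> /(bT n _ phi2P) /(aT n _ phi1P) /(b'T n _ phi2P) /(a'T n _ phi1P).
apply: eq_cubes => v; rewrite /on_top phiE cube_split_eq1.
by case: (phi1 v == _); case: (phi2 v == _) => /=; rewrite ?aK ?bK.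
Qed.

(** * Invertibility of translations *)

Section HeightOne.
Variable a : N -> N.
Hypothesis aT : translation N 1 a.

Lemma translation_face n (i : 'I_n) (c : cube n -> N) : cubes c ->
  cubes (fun v : cube n => if v i then a (c v) else c v).
Proof.
have phiP := cube_morphism_coord (fun _ : 'I_1 => i).
move=> /((translationP 1 a).1 aT n _ phiP).
apply: eq_cubes => v; rewrite /on_top; congr (if _ then _ else _).
apply/eqP/idP => [/ffunP/(_ ord0)|vi]; first by rewrite !ffunE.
by apply/ffunP => j; rewrite !ffunE.
Qed.

(* Glue the corner equal to [set_top (a x) y] on one face and to [x] on the
   opposite one; the new vertex is [x']. Concatenating with the pair
   [set_top x x'], [a (set_top x x')] along [set_top x x'] gives the claim. *)
Lemma crel_lift m x y : crel m (a x) y ->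
  exists2 x', crel m x x' & crel m.+1 (a x') y.
Proof.
move=> axy.
pose tl := @cube_del m ord0.
pose f (v : cube m.+1) := if v ord0 then x else set_top (fun=> a x) y (tl v).
have fC : corner (@cubes N) f.
  move=> i; case: (unliftP ord0 i) => [j|] ->.
    have := cubes_comp (cube_morphism_face0 (lift ord0 j))
      (cubes_edge ord0 (a x) x).
    apply: eq_cubes => v /=; rewrite /f; case: ifP => // _.
    by rewrite (set_topF _ _ (i := j)) // !ffunE unlift_none.
  apply: eq_cubes axy => v.
  by rewrite /f /= ffunE unlift_none /tl cube_del_face0.
have [h [hC hE]] := cubes_glue fC.
pose x' := h (cube1 m.+1).
pose g := set_top (fun _ : cube m => x) x'.
have hg v : h (cube_cons true v) = g v.
  rewrite /g /set_top; case: eqP => [->|/eqP v1].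
    by congr h; apply/eqP; rewrite cube_cons_eq1 eqxx.
  by rewrite hE ?cube_cons_eq1 // /f cube_cons0.
have gC : crel m x x'.
  by apply: eq_cubes (cubes_comp (@cube_morphism_cons m true) hC) => v /=.
exists x' => //.
have gtC := cubes_comp (@cube_morphism_del m ord0) gC.
have hfC := cubes_comp (cube_morphism_flip ord0) hC.
have hfE (v : cube m.+1) : (h \o cube_flip ord0) v =
    if v ord0 then set_top (fun=> a x) y (tl v) else g (tl v).
  rewrite /= [cube_flip _ _]cube_consE.
  have -> : cube_del ord0 (cube_flip ord0 v) = tl v.
    by apply/ffunP => j; rewrite !ffunE eq_sym (negPf (neq_lift _ _)).
  rewrite ffunE eqxx /=; case: (v ord0) => /=; last exact: hg.
  by rewrite hE ?cube_cons_eq1 // /f cube_cons0 /tl cube_consK.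
have agree (v : cube m.+1) : v ord0 = false ->
    (if v ord0 then a (g (tl v)) else g (tl v)) = (h \o cube_flip ord0) v.
  by move=> v0; rewrite hfE v0.
have tl_set (v : cube m.+1) : tl (cube_set ord0 true v) = tl v.
  by apply/ffunP => j; rewrite !ffunE eq_sym (negPf (neq_lift _ _)).
have := cubes_concat (translation_face ord0 gtC) hfC agree.
pose A (v : cube m.+1) := a (g (tl v)).
have AC : cubes A.
  have := cubes_comp (cube_morphism_set ord0 true) (translation_face ord0 gtC).
  by apply: eq_cubes => v; rewrite /= ffunE eqxx -/tl tl_set.
(* The concatenation is [A] with top value changed to [y], so [set_top_cubes] applies. *)
suff -> : a x' = A (cube1 m.+1).
  move=> H; apply/(set_top_cubes _ AC); apply: eq_cubes H => v.
  rewrite hfE /= -/tl tl_set ffunE eqxx /set_top [v in RHS]cube_consE.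
  rewrite cube_cons_eq1 -/tl -cube_consE /A /g /set_top.
  by case: (v ord0) => //=; case: ifP.
rewrite /A /g; have -> : tl (cube1 m.+1) = cube1 m.
  by apply/ffunP => j; rewrite !ffunE.
by rewrite set_top1.
Qed.

Variable k : nat.
Hypothesis kN : is_step k N.

Lemma step_unique (c d : cube k.+1 -> N) : cubes c -> cubes d ->
  (forall v, v != cube1 k.+1 -> c v = d v) -> c (cube1 k.+1) = d (cube1 k.+1).
Proof.
move=> cC dC cd.
have fC : corner (@cubes N) c.
  by move=> i; apply: cubes_comp (cube_morphism_face0 i) _ cC.
have [e [_ eU]] := kN fC.
by rewrite -(eU c) ?(eU d) //; split=> // v /cd.
Qed.

Lemma crel_eq m x y : k < m -> crel m x y -> x = y.
Proof.
move=> km /(crel_leq km) xy.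
have := step_unique (cubes_cst k.+1 x) xy; rewrite set_top1; apply.
by move=> v v1; rewrite /set_top (negPf v1).
Qed.

(** If [a x = a y], applying [a] to one of two copies of [set_top x y] makes that copy constant;
    concatenation with an edge from [a x] to [x] raises the dimension of the relation by one. *)
Lemma translation_inj : injective a.
Proof.
move=> x y axy; apply: (@crel_eq k.+1) => //.
elim: k.+1 => [|m IHm]; first exact: crel0.
have eC := cubes_comp (@cube_morphism_del m ord0) IHm.
have dC := cubes_comp (cube_morphism_flip ord0) (translation_face ord0 eC).
have cd (v : cube m.+1) : v ord0 = false -> (if v ord0 then x else a x) =
    ((fun v : cube m.+1 => if v ord0 then a (set_top (fun=> x) y (cube_del ord0 v))
      else set_top (fun=> x) y (cube_del ord0 v)) \o cube_flip ord0) v.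
  by move=> v0; rewrite /= ffunE v0 eqxx /= /set_top; case: ifP.
apply: eq_cubes (cubes_concat (cubes_edge ord0 (a x) x) dC cd) => v.
rewrite [v in RHS]cube_consE /set_top cube_cons_eq1 /= !ffunE eqxx.
case: (v ord0) => //=; congr (if _ == _ then _ else _).
by apply/ffunP => j; rewrite !ffunE eq_sym (negPf (neq_lift _ _)).
Qed.

(** [crel_lift] is iterated until dimension [k+1], where the relation is equality. *)
Lemma crel_preimage m x y : crel m (a x) y -> exists2 x', a x' = y & crel m x x'.
Proof.
have [d] := ubnP (k.+1 - m); elim: d m x y => // d IHd m x y lt_d axy.
have [km|mk] := ltnP k m.
  exists x; first exact: crel_eq axy.
  by apply: eq_cubes (cubes_cst m x) => v; rewrite /set_top if_same.
have [x1 xx1 ax1y] := crel_lift axy.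
have [|x' ax' x1x'] := IHd _ _ _ _ ax1y.
  by rewrite subSS; move: lt_d; rewrite subSn // !ltnS.
by exists x' => //; apply: crel_trans xx1 (crelS x1x').
Qed.

Lemma translation_bij : bijective a.
Proof.
have /choice[b bK] : forall y, exists x, a x = y.
  by move=> y; have [x xy _] := crel_preimage (crel0 (a y) y); exists x.
by exists b => // x; apply: translation_inj; rewrite bK.
Qed.

End HeightOne.

(* By induction on the dimension, the transformed map is a corner. It extends
   to a cube [h], whose value at the top differs from the desired one by an
   element related to it by [crel]. *)
Lemma translation_inv k i a b : is_step k N -> 1 <= i -> cancel a b ->
  cancel b a -> translation N i a -> translation N i b.
Proof.
move=> kN i1 aK bK aT; have aT1 := translation_leq i1 aT.
apply/translationP; elim=> [|n IHn] phi phiP c cC; first exact: cubes0.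
have fC : corner (@cubes N) (on_top phi b c).
  move=> j; have mP := cube_morphism_face0 j.
  exact: IHn (cube_morphism_comp mP phiP) _ (cubes_comp mP cC).
have [h [hC hE]] := cubes_glue fC.
pose t := on_top phi b c (cube1 n.+1).
suff tC : cubes (set_top h t).
  by apply: eq_cubes tC => v; rewrite /set_top; case: eqP => [->|/eqP/hE].
(* Applying [a] to [h] on the same set recovers [c] except at the top, so the two top values are
   related; [crel_preimage] then removes [a]. *)
apply/(set_top_cubes _ hC); have ahC := (translationP i a).1 aT _ _ phiP _ hC.
have: cubes (set_top (on_top phi a h) (c (cube1 n.+1))).
  apply: eq_cubes cC => v; rewrite /set_top; case: eqP => [->|/eqP/hE hv] //.
  by rewrite /on_top hv /on_top; case: (phi v == _); rewrite ?bK.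
move=> /(set_top_cubes _ ahC); rewrite /t /on_top; case: ifP => // _.
by move=> /(crel_preimage aT1 kN)[x <-]; rewrite aK.
Qed.

(** * The translation groups as a central series *)

(** Height [k+1] allows changing a constant [k+1]-cube at its top only, where the value is
    forced. *)
Lemma translation_step k a : is_step k N -> translation N k.+1 a -> a =1 id.
Proof.
move=> kN /translationP aT x.
have aC := aT _ _ (@cube_morphism_id k.+1) _ (cubes_cst k.+1 x).
have := step_unique kN aC (cubes_cst k.+1 x); rewrite /on_top eqxx; apply.
by move=> v /negPf ->.
Qed.

Lemma subgroup_Trans k i : is_step k N -> 1 <= i -> subgroup (Trans N i).
Proof.
move=> kN i1; split; first by rewrite in_setE; exact: translation_id.
move=> s t; rewrite !in_setE => sT tT; apply: translation_comp sT _.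
exact: translation_inv kN i1 (sym_funK t) (sym_invK t) tT.
Qed.

Lemma Trans_leq i j : i <= j -> (Trans N j `<=` Trans N i)%classic.
Proof. by move=> ij s; apply: translation_leq. Qed.

Lemma Trans_step k : is_step k N -> Trans N k.+1 = [set 1%g]%classic.
Proof.
move=> kN; apply/seteqP; split=> [s sT|s ->]; last exact: translation_id.
by apply: sym_inj; apply: funext; apply: translation_step kN sT.
Qed.

(** [A] and [B] are arbitrary subsets so that iterated commutators can be inserted; it suffices to
    treat generators. *)
Lemma commutator_Trans k i j (A B : set (sym N)) :
  is_step k N -> 1 <= i -> 1 <= j -> (A `<=` Trans N i)%classic ->
  (B `<=` Trans N j)%classic -> (commutator A B `<=` Trans N (i + j))%classic.
Proof.
move=> kN i1 j1 Ai Bj; apply: smallest_sub.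
  by apply: subgroup_Trans kN _; rewrite addn_gt0 i1.
move=> _ [s [t [/Ai sT /Bj tT ->]]].
apply: (translation_commutator (sym_funK s) (sym_funK t)) => //.
  exact: translation_inv kN i1 (sym_funK s) (sym_invK s) sT.
exact: translation_inv kN j1 (sym_funK t) (sym_invK t) tT.
Qed.

End Nilspace.

(* The first two conjuncts say that Trans_i(N), a set of maps, is a group under
   composition: all its elements are permutations of N, and they form a subgroup
   of the group of all permutations of N. *)
Theorem corollary2p5 (N : nilspace) (k : nat) (hk : 1 <= k) (hN : is_step k N) :
  [/\ forall (i : nat) (a : N -> N), 1 <= i -> translation N i a -> bijective a,
      forall i : nat, 1 <= i -> subgroup (Trans N i),
      nilpotent k (Trans N 1) &
      central_series k (Trans N 1) (Trans N)].
Proof.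
split.
- by move=> i a i1 /(translation_leq i1) aT; apply: translation_bij hN.
- by move=> i; apply: subgroup_Trans hN.
- rewrite /nilpotent; apply/seteqP; split; last first.
    (* As [k >= 1], the iterate is a generated subgroup and contains 1. *)
    move=> _ ->; case: k hk {hN} => // k _ A [[A1 _] _].
    by rewrite -in_setE.
  have sub m : (iter m (fun L => commutator L (Trans N 1)) (Trans N 1)
      `<=` Trans N m.+1)%classic.
    elim: m => //= m IHm; rewrite -[m.+2]addn1.
    exact: commutator_Trans hN _ _ IHm _.
  by rewrite -(Trans_step hN); apply: sub.
- split=> //.
  + exact: Trans_step hN.
  + by move=> i /andP[i1 _]; apply: subgroup_Trans hN i1.
  + by move=> i _; apply: Trans_leq.
  + move=> i j /andP[i1 _] /andP[j1 _].
    have := commutator_Trans hN i1 j1 (@subset_refl _ _) (@subset_refl _ _).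
    (* Beyond [k+1], the height is lowered to [k+1], where the group is trivial. *)
    case: leqP => // /ltnW lt_k sub; rewrite -(Trans_step hN).
    by apply: subset_trans sub _; apply: Trans_leq.
Qed.
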